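(* Let $0\le L<U<\infty$, $\beta_1\ge 0$, $\beta_2>0$, $\beta_3>0$, let $n_1,n_2,n_3$ be positive integers, and write $\mu(x)=\beta_1+\beta_2x^{\beta_3}$ and $\mu_i=\mu(x_i)$. Let $g$ be a canonical link function as described in the context, and for stimuli $L\le x_1<x_2<x_3\le U$ let $$|I_{3\times3}(\boldsymbol\beta)|=\beta_2^2\left[(x_1x_2)^{\beta_3}\log\left(\tfrac{x_2}{x_1}\right)-(x_1x_3)^{\beta_3}\log\left(\tfrac{x_3}{x_1}\right)+(x_2x_3)^{\beta_3}\log\left(\tfrac{x_3}{x_2}\right)\right]^2\prod_{i=1}^3\left[n_i\,g'(\mu_i)\right].$$ Suppose that $g'(\mu)\ge 0$ and $g''(\mu)\le 0$ for all attainable means $\mu\in\{\mu(x):x\in[L,U]\}$. Then, for any given $x_2,x_3$ with $L<x_2<x_3\le U$, the optimal stimulus $x_1^{\mathrm{opt}}$, i.e. the value of $x_1\in[L,x_2)$ that maximizes $|I_{3\times3}(\boldsymbol\beta)|$, is the smallest possible stimulus value: $x_1^{\mathrm{opt}}=L$.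
   Context: Setting: independent responses $y_{ij}$, $j=1,\dots,n_i$, at stimulus $x_i\ge 0$, $i=1,2,3$, have density $\exp\{[y\theta_i-b(\theta_i)]/a(\phi)+c(y,\phi)\}$ with $b$ at least twice differentiable, so that $\mathbb{E}(y_{ij}|x_i)=\mu_i=b'(\theta_i)$ and $\mathrm{Var}(y_{ij}|x_i)=b''(\theta_i)a(\phi)$. The mean is the Mitscherlich function $\mu_i=\beta_1+\beta_2x_i^{\beta_3}$, with $\boldsymbol\beta=(\beta_1,\beta_2,\beta_3)^T$. The canonical link $g$ satisfies $\theta_i=g(\mu_i)$, i.e. $g$ is the inverse of $b'$ (hence $g'(\mu)\,b''(g(\mu))=1$). It is a twice differentiable real function on an open interval containing all attainable means $\mu(x)=\beta_1+\beta_2x^{\beta_3}$, $x\in[L,U]$. $I_{3\times3}(\boldsymbol\beta)$ is the $3\times 3$ matrix with entries $\sum_{i=1}^3 n_i g'(\mu_i)\frac{\partial\mu_i}{\partial\beta_r}\frac{\partial\mu_i}{\partial\beta_s}$ (the Fisher information for $\boldsymbol\beta$ up to the factor $1/a(\phi)$); its determinant is the expression displayed in the claim. Convention: when $x_1=0$, terms of the form $x_1^{\beta_3}\log(c/x_1)$ with $c>0$ are read as their limit $0$. *)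

(* Defs.v *)
From HB Require Import structures.
From mathcomp Require Import all_boot all_order all_algebra.
From mathcomp Require Import all_classical all_reals all_analysis.
Import Order.TTheory GRing.Theory Num.Theory numFieldNormedType.Exports.

Set Implicit Arguments.
Unset Strict Implicit.
Unset Printing Implicit Defensive.

Local Open Scope ring_scope.
Local Open Scope classical_set_scope.

Definition open_interval (R : realType) (A : set R) : Prop :=
  open A /\ is_interval A.

Definition twice_derivable_on (R : realType) (A : set R) (f : R -> R) : Prop :=
  forall x, A x -> derivable f x 1 /\ derivable f^`() x 1.

(* [b] is the cumulant function of the exponential family with density
   exp ((y theta - b theta) / a(phi) + c(y, phi)), defined for theta in [Theta],
   so that the mean is b'(theta).  Since [b] and [g] are total functions, "g is
   the inverse of b'" is relative to the open intervals [Theta] of canonical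
   parameters and [M] of means. *)
Definition canonical_link (R : realType) (Theta : set R) (b : R -> R)
    (M : set R) (g : R -> R) : Prop :=
  [/\ open_interval Theta /\ twice_derivable_on Theta b,
      open_interval M /\ twice_derivable_on M g,
      forall mu, M mu -> Theta (g mu) /\ b^`() (g mu) = mu &
      forall theta, Theta theta -> M (b^`() theta) -> g (b^`() theta) = theta].

(* beta = (beta_1, beta_2, beta_3)^T is indexed from 0. *)
Definition mitscherlich (R : realType) (beta : 'cV[R]_3) (x : R) : R :=
  beta 0 0 + beta 1 0 * x `^ (beta 2 0).

Definition attainable_means (R : realType) (L U : R) (beta : 'cV[R]_3) : set R :=
  mitscherlich beta @` `[L, U].

(* The partial derivative of the mean at stimulus [x] with respect to the
   [r]-th parameter, as a derivative along the [r]-th basis vector. *)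
Definition dmean (R : realType) (beta : 'cV[R]_3) (x : R) (r : 'I_3) : R :=
  'D_(delta_mx r 0) (fun b : 'cV[R]_3 => mitscherlich b x) beta.

(* Fisher information for beta, up to the factor 1 / a(phi). *)
Definition fisher_info (R : realType) (g : R -> R) (n : 3.-tuple nat)
    (beta : 'cV[R]_3) (x : 3.-tuple R) : 'M[R]_3 :=
  \matrix_(r < 3, s < 3) \sum_(i < 3)
    (tnth n i)%:R * derive1 g (mitscherlich beta (tnth x i))
      * dmean beta (tnth x i) r * dmean beta (tnth x i) s.

Definition param (R : realType) (beta1 beta2 beta3 : R) : 'cV[R]_3 :=
  \col_(i < 3) tnth [tuple beta1; beta2; beta3] i.

Definition is_argmax (R : realType) (A : set R) (f : R -> R) (x : R) : Prop :=
  A x /\ forall y, A y -> f y <= f x.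

(* Main.v *)
Require Import Defs.
From HB Require Import structures.
From mathcomp Require Import all_boot all_order all_algebra.
From mathcomp Require Import all_classical all_reals all_analysis.
From mathcomp Require Import ring lra.
Import Order.TTheory GRing.Theory Num.Theory numFieldNormedType.Exports.
Local Open Scope ring_scope.
Local Open Scope classical_set_scope.

Set Implicit Arguments.
Unset Strict Implicit.
Unset Printing Implicit Defensive.

(** The Fisher information is J^T diag(n_i g'(mu_i)) J, where J is the Jacobian
    of the means (mu_1, mu_2, mu_3) with respect to beta, so its determinant is
    (det J)^2 times the product of the weights [det_fisher_info].  Put
    u_i = x_i ^ beta3.  The rows of J are (1, u_i, beta2 u_i ln x_i), and
    u_i ln x_i = u_i ln u_i / beta3; hence det J is beta2 / beta3 times the
    determinant [xlnx_gap] of the rows (1, u_i, u_i ln u_i)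
    [det_mean_jacobian].  This determinant measures the convexity of t ln t:
    for fixed u_2 < u_3 it is positive and strictly decreasing in u_1 on
    [0, u_2), since chord slopes of a strictly convex function increase
    [xlnx_gap_ltr].  Thus (det J)^2 strictly decreases in x_1.

    Among the weights only g'(mu_1) depends on x_1.  It does not increase with
    x_1, because mu is increasing and g'' <= 0 on the means
    [concave_derive1_le].  All the weights are positive, and not just
    nonnegative, because g is a differentiable inverse of b'
    [canonical_link_derive_neq0].  So the product strictly decreases on
    [L, x_2), and L is its unique maximizer.  With the conventions 0 ln 0 = 0
    and 0 ^ beta3 = 0 the argument includes L = 0. *)

(** * Strict convexity of t ln t *)

(** Strict convexity of t ln t, in the form that uses only ln t < t - 1 for
    t <> 1, taken at t = x / y.  The tangent point is positive but [y] may be 0,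
    since [ln 0 = 0] makes 0 ln 0 equal to its limit 0. *)
Lemma xlnx_above_tangent (R : realType) (x y : R) :
  0 < x -> 0 <= y -> y != x ->
  x * ln x + (ln x + 1) * (y - x) < y * ln y.
Proof.
move=> x0; rewrite le_eqVlt => /predU1P[<- _|y0 yx].
  by rewrite mul0r; lra.
have xy0 : 0 < x / y by rewrite divr_gt0.
have : 1 + ln (x / y) < x / y.
  rewrite -[ltRHS](@lnK _ (x / y)) ?posrE //; apply: expR_gt1Dx.
  rewrite ln_eq0 //; apply: contra yx => /eqP xy.
  by rewrite -[x](divfK (lt0r_neq0 y0)) // xy mul1r.
rewrite ln_div ?posrE // ltr_pdivlMr //; lra.
Qed.

(** The determinant of the matrix with rows (1, t, t ln t) for t = u, v, w:
    up to the factor (v - u)(w - v)(w - u), the second divided difference of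
    t ln t. *)
Definition xlnx_gap (R : realType) (u v w : R) : R :=
  (w - v) * (u * ln u) - (w - u) * (v * ln v) + (v - u) * (w * ln w).

(** The decrease of the gap is (w - v)(u2 - u1) times the slope of the chord of
    t ln t over [v, w] minus that of the chord over [u1, u2].  The tangent slopes
    at [v] and at [u2] separate these two chords. *)
Lemma xlnx_gap_ltr (R : realType) (u1 u2 v w : R) :
  0 <= u1 -> u1 < u2 -> u2 <= v -> v < w ->
  xlnx_gap u2 v w < xlnx_gap u1 v w.
Proof.
move=> u10 u12 u2v vw.
have u20 : 0 < u2 by exact: le_lt_trans u12.
have v0 : 0 < v by exact: lt_le_trans u2v.
have chord1 := @xlnx_above_tangent R u2 u1 u20 u10 (negbT (lt_eqF u12)).
have chord2 := @xlnx_above_tangent R v w v0 (ltW (lt_trans v0 vw))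
  (negbT (gt_eqF vw)).
have lnuv : ln u2 <= ln v by rewrite ler_ln.
have wv0 : 0 < w - v by rewrite subr_gt0.
have u210 : 0 < u2 - u1 by rewrite subr_gt0.
rewrite -subr_gt0 in chord1; rewrite -subr_gt0 in chord2.
rewrite -subr_ge0 in lnuv; rewrite -subr_gt0 /xlnx_gap.
have := mulr_gt0 wv0 chord1; have := mulr_gt0 u210 chord2.
have := mulr_ge0 (ltW (mulr_gt0 wv0 u210)) lnuv.
lra.
Qed.

(** The gap decreases in [u] down to its value 0 at u = v. *)
Lemma xlnx_gap_gt0 (R : realType) (u v w : R) :
  0 <= u -> u < v -> v < w -> 0 < xlnx_gap u v w.
Proof.
move=> u0 uv vw.
rewrite (_ : 0 = xlnx_gap v v w); first exact: xlnx_gap_ltr.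
rewrite /xlnx_gap; ring.
Qed.

(** Recovers the expression of the claim; the terms with ln x1 must be treated
    apart at x1 = 0, where the powers of x1 vanish. *)
Lemma xlnx_gap_powR (R : realType) (p x1 x2 x3 : R) :
  0 < p -> 0 <= x1 -> 0 < x2 -> 0 < x3 ->
  xlnx_gap (x1 `^ p) (x2 `^ p) (x3 `^ p)
  = p * ((x1 * x2) `^ p * ln (x2 / x1) - (x1 * x3) `^ p * ln (x3 / x1)
         + (x2 * x3) `^ p * ln (x3 / x2)).
Proof.
move=> p0 x10 x20 x30; rewrite /xlnx_gap !ln_powR.
rewrite !powRM ?(ltW x20, ltW x30) // (ln_div x30 x20).
move: x10; rewrite le_eqVlt => /predU1P[<-|x10].
  by rewrite powR0 ?gt_eqF //; ring.
by rewrite !ln_div ?posrE //; ring.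
Qed.

(** * Derivatives of the Mitscherlich mean *)

(** Reduces a directional derivative to one in a real variable, where the
    usual differentiation rules apply. *)
Lemma derive_along (R : realType) (V W : normedModType R) (f : V -> W)
    (a v : V) :
  'D_v f a = derive1 (fun h : R => f (h *: v + a)) 0.
Proof.
rewrite /derive /derive1 /= scale0r add0r.
by under [in RHS]eq_fun do rewrite addr0.
Qed.

(** At x = 0 the power vanishes for all exponents near [p], and the right-hand
    side is 0 as well. *)
Lemma is_derive_powR_exponent (R : realType) (x p : R) :
  0 <= x -> 0 < p ->
  is_derive (0 : R) 1 (fun h => x `^ (h + p)) (x `^ p * ln x).
Proof.
rewrite le_eqVlt => /predU1P[<- p0|x0 p0].
  rewrite ln0 // mulr0.
  apply: (near_eq_is_derive _ (is_derive_cst (0 : R) (0 : R) 1)).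
  near=> h; rewrite powR0 // gt_eqF // -ltrBlDr sub0r.
  by near: h; apply: lt_nbhsr; rewrite oppr_lt0.
have -> : (fun h => x `^ (h + p)) = (fun h => expR ((h + p) * ln x)).
  by apply/funext => h; rewrite /powR gt_eqF.
have dlin : is_derive (0 : R) 1 (fun h => (h + p) * ln x) (ln x).
  by apply: is_derive_eq; rewrite addr0 scaler0 add0r [_%:A]mulr1.
have dexp := is_derive_expR ((0 + p) * ln x).
pose e (h : R) := (h + p) * ln x.
apply: (is_derive_eq (is_derive1_comp (g := e) dexp dlin)).
by rewrite add0r /powR gt_eqF // mulrC.
Unshelve. all: by end_near. Qed.

Lemma dmean_param (R : realType) (beta1 beta2 beta3 x : R) (r : 'I_3) :
  0 <= x -> 0 < beta3 ->
  dmean (param beta1 beta2 beta3) x r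
  = tnth [tuple 1; x `^ beta3; beta2 * (x `^ beta3 * ln x)] r.
Proof.
move=> x0 b30; rewrite /dmean derive_along /mitscherlich.
under eq_fun do rewrite !mxE/= /tnth /=.
have dexp := is_derive_powR_exponent x0 b30.
case: r => -[|[|[|//]]] ? /=; rewrite derive1E /tnth/=; apply: derive_val.
- under eq_fun do rewrite mulr1 mulr0 !add0r.
  by apply: is_derive_eq; rewrite !addr0.
- under eq_fun do rewrite mulr1 !mulr0 !add0r.
  move: (x `^ beta3) => {x x0 dexp} c.
  by apply: is_derive_eq; rewrite scaler0 !add0r addr0 mul1r [c%:A]mulr1.
- under eq_fun do rewrite mulr1 !mulr0 !add0r.
  by apply: is_derive_eq; rewrite add0r mul1r.
Qed.

(** * The determinant of the Fisher information *)

(** The matrix is A^T diag(w) A. *)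
Lemma det_weighted_gram (R : comNzRingType) (n : nat) (w : 'I_n -> R)
    (A : 'M[R]_n) :
  \det (\matrix_(r, s) \sum_i w i * A i r * A i s)
  = (\det A) ^+ 2 * \prod_i w i.
Proof.
have -> : \matrix_(r, s) (\sum_i w i * A i r * A i s)
    = A^T *m diag_mx (\row_i w i) *m A.
  apply/matrixP => r s; rewrite !mxE; apply: eq_bigr => i _.
  by rewrite mul_mx_diag !mxE [w i * _]mulrC.
rewrite !det_mulmx det_tr det_diag mulrAC -expr2; congr (_ * _).
by apply: eq_bigr => i _; rewrite mxE.
Qed.

Lemma det_mx33 (R : comNzRingType) (A : 'M[R]_3) :
  \det A = A 0 0 * (A 1 1 * A 2 2 - A 1 2 * A 2 1)
         - A 0 1 * (A 1 0 * A 2 2 - A 1 2 * A 2 0)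
         + A 0 2 * (A 1 0 * A 2 1 - A 1 1 * A 2 0).
Proof.
(* Entries are indexed by the values of the ordinals, so that the nested lifts
   of the expansion compute. *)
pose a (i j : nat) := A (inord i) (inord j).
have Aa i j : A i j = a i j by rewrite /a !inord_val.
rewrite (expand_det_row _ 0) !big_ord_recl big_ord0 /cofactor.
rewrite !(expand_det_row _ 0) !big_ord_recl !big_ord0 /cofactor !det_mx11 !mxE.
rewrite !Aa /= /bump /=.
ring.
Qed.

Lemma det_fisher_info (R : realType) (g : R -> R) (n : 3.-tuple nat)
    (beta : 'cV[R]_3) (x : 3.-tuple R) :
  \det (fisher_info g n beta x)
  = (\det (\matrix_(i, r) dmean beta (tnth x i) r)) ^+ 2
    * \prod_i ((tnth n i)%:R * derive1 g (mitscherlich beta (tnth x i))).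
Proof.
rewrite -det_weighted_gram; congr (\det _); apply/matrixP => r s.
by rewrite !mxE; apply: eq_bigr => i _; rewrite !mxE.
Qed.

(** The rows (1, u, beta2 u ln x) with u = x ^ beta3 become rows
    (1, u, u ln u) once beta2 / beta3 is taken out of the last column, because
    ln u = beta3 ln x; this also holds at x = 0. *)
Lemma det_mean_jacobian (R : realType) (beta1 beta2 beta3 x1 x2 x3 : R) :
  0 <= x1 -> 0 <= x2 -> 0 <= x3 -> 0 < beta3 ->
  \det (\matrix_(i, r)
    dmean (param beta1 beta2 beta3) (tnth [tuple x1; x2; x3] i) r)
  = beta2 / beta3 * xlnx_gap (x1 `^ beta3) (x2 `^ beta3) (x3 `^ beta3).
Proof.
move=> x10 x20 x30 b30.
rewrite det_mx33 !mxE !dmean_param ?(tnth_nth 0) //= /xlnx_gap !ln_powR.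
by field; rewrite gt_eqF.
Qed.

Lemma det_fisher_info_mitscherlich (R : realType) (g : R -> R)
    (n1 n2 n3 : nat) (beta1 beta2 beta3 x1 x2 x3 : R) :
  0 <= x1 -> 0 <= x2 -> 0 <= x3 -> 0 < beta3 ->
  let mu := mitscherlich (param beta1 beta2 beta3) in
  \det (fisher_info g [tuple n1; n2; n3] (param beta1 beta2 beta3)
         [tuple x1; x2; x3])
  = (beta2 / beta3 * xlnx_gap (x1 `^ beta3) (x2 `^ beta3) (x3 `^ beta3)) ^+ 2 *
    (n1%:R * derive1 g (mu x1) * (n2%:R * derive1 g (mu x2))
      * (n3%:R * derive1 g (mu x3))).
Proof.
move=> x10 x20 x30 b30; rewrite /= det_fisher_info det_mean_jacobian //.
by rewrite 2!big_ord_recl big_ord1 mulrA.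
Qed.

(** * Attainable means and the canonical link *)

Lemma mitscherlich_le (R : realType) (beta1 beta2 beta3 x y : R) :
  0 < beta2 -> 0 < beta3 -> 0 <= x -> x <= y ->
  mitscherlich (param beta1 beta2 beta3) x
  <= mitscherlich (param beta1 beta2 beta3) y.
Proof.
move=> b20 b30 x0 xy.
rewrite /mitscherlich !mxE /tnth /= lerD2l ler_pM2l //.
by rewrite ge0_ler_powR ?nnegrE ?(le_trans x0 xy) // ltW.
Qed.

(** The mean function is inverted explicitly, by
    c |-> ((c - beta1) / beta2) ^ (1 / beta3).  Hence the sign of g'' is known on
    a whole interval of means, as the mean value theorem requires. *)
Lemma attainable_means_itv (R : realType) (L U beta1 beta2 beta3 c : R) :
  let mu := mitscherlich (param beta1 beta2 beta3) in
  0 <= L -> L <= U -> 0 < beta2 -> 0 < beta3 ->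
  mu L <= c <= mu U -> attainable_means L U (param beta1 beta2 beta3) c.
Proof.
move=> mu L0 LU b20 b30; rewrite /mu /mitscherlich !mxE /tnth /= => /andP[Lc cU].
pose t := (c - beta1) / beta2.
have Lt : L `^ beta3 <= t by rewrite ler_pdivlMr //; lra.
have tU : t <= U `^ beta3 by rewrite ler_pdivrMr //; lra.
have t0 : 0 <= t by exact: le_trans (powR_ge0 _ _) Lt.
have rootK y : 0 <= y -> (y `^ beta3) `^ beta3^-1 = y.
  by move=> y0; rewrite -powRrM mulfV ?gt_eqF // powRr1.
have b3V : 0 <= beta3^-1 by rewrite invr_ge0 ltW.
exists (t `^ beta3^-1).
  rewrite /= in_itv /=; apply/andP; split.
    by rewrite -[leLHS]rootK // ge0_ler_powR ?nnegrE ?powR_ge0.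
  by rewrite -[leRHS]rootK ?ge0_ler_powR ?nnegrE ?powR_ge0 //; lra.
rewrite /mitscherlich !mxE /tnth /= -powRrM mulVf ?gt_eqF // powRr1 // /t.
by field; rewrite gt_eqF.
Qed.

(** Differentiating b'(g(mu)) = mu, which holds near [m] since [M] is open, gives
    b''(g(m)) g'(m) = 1. *)
Lemma canonical_link_derive_neq0 (R : realType) (Theta M : set R)
    (b g : R -> R) (m : R) :
  canonical_link Theta b M g -> M m -> derive1 g m != 0.
Proof.
move=> [[_ db] [[oM _] dg] gK _] Mm.
have [Tgm _] := gK _ Mm.
have : derive1 (derive1 b \o g) m = 1.
  have <- : 'D_1 (@id R) m = 1 by exact: derive_val.
  rewrite derive1E.
  apply: near_eq_derive.
  by apply: filterS (oM _ Mm) => y /gK[].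
rewrite derive1_comp; [|exact: (dg _ Mm).1|exact: (db _ Tgm).2].
by move=> bg; apply: contra_eq_neq bg => ->; rewrite mulr0 eq_sym oner_neq0.
Qed.

Lemma concave_derive1_le (R : realType) (M : set R) (g : R -> R)
    (p q : R) :
  twice_derivable_on M g -> p <= q -> `[p, q] `<=` M ->
  (forall m, p <= m <= q -> derive1 (derive1 g) m <= 0) ->
  derive1 g q <= derive1 g p.
Proof.
move=> dg pq pqM g2.
have dg1 x : x \in `[p, q] -> derivable (derive1 g) x 1.
  by rewrite inE => /pqM/dg[].
apply: (@ler0_derive1_nincr _ _ p q) => //.
- by move=> x xpq; apply: dg1; rewrite inE; exact: subset_itv_oo_cc.
- by move=> x /subset_itv_oo_cc/g2.
- apply: derivable_within_continuous => x xpq; by apply: dg1; rewrite inE.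
Qed.

(** * The optimal smallest stimulus *)

Lemma is_argmax_left (R : realType) (f : R -> R) (p q x : R) :
  p < q -> (forall y, p < y -> y < q -> f y < f p) ->
  is_argmax `[p, q[ f x <-> x = p.
Proof.
move=> pq flt; split=> [[]|->].
  rewrite /= in_itv /= => /andP[px xq] /(_ p).
  rewrite /= in_itv /= lexx pq => /(_ isT) fpx.
  apply/eqP; rewrite eq_le px andbT leNgt; apply/negP => px'.
  by have := flt _ px' xq; rewrite ltNge fpx.
split=> [|y]; rewrite /= in_itv /= ?lexx // => /andP[].
by rewrite le_eqVlt => /predU1P[-> //|py /flt - /(_ py)/ltW].
Qed.

(* The terms (x1 x_j)^beta3 log(x_j / x1) vanish at x1 = 0, as required, since
   0 `^ beta3 = 0 for beta3 > 0 in the library. *)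
Theorem theorem1 (R : realType) (L U beta1 beta2 beta3 : R) (n1 n2 n3 : nat)
    (Theta M : set R) (b g : R -> R)
    (beta := param beta1 beta2 beta3)
    (mu := mitscherlich beta)
    (detI := fun x1 x2 x3 : R =>
       \det (fisher_info g [tuple n1; n2; n3] beta [tuple x1; x2; x3])) :
  0 <= L -> L < U ->
  0 <= beta1 -> 0 < beta2 -> 0 < beta3 ->
  (0 < n1)%N -> (0 < n2)%N -> (0 < n3)%N ->
  canonical_link Theta b M g ->
  attainable_means L U beta `<=` M ->
  (forall m, attainable_means L U beta m -> 0 <= derive1 g m) ->
  (forall m, attainable_means L U beta m -> derive1 (derive1 g) m <= 0) ->
  (forall x1 x2 x3 : R, L <= x1 -> x1 < x2 -> x2 < x3 -> x3 <= U ->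
     detI x1 x2 x3 =
       beta2 ^+ 2 *
       ((x1 * x2) `^ beta3 * ln (x2 / x1) - (x1 * x3) `^ beta3 * ln (x3 / x1)
          + (x2 * x3) `^ beta3 * ln (x3 / x2)) ^+ 2 *
       (n1%:R * derive1 g (mu x1) * (n2%:R * derive1 g (mu x2))
          * (n3%:R * derive1 g (mu x3)))) /\
  (forall x2 x3 : R, L < x2 -> x2 < x3 -> x3 <= U ->
     forall x1opt : R,
       is_argmax `[L, x2[ (fun x1 => detI x1 x2 x3) x1opt <-> x1opt = L).
Proof.
move=> L0 LU b10 b20 b30 n10 n20 n30 link attM g1_ge0 g2_le0.
have detE x1 x2 x3 : 0 <= x1 -> 0 <= x2 -> 0 <= x3 -> detI x1 x2 x3 =
    (beta2 / beta3 * xlnx_gap (x1 `^ beta3) (x2 `^ beta3) (x3 `^ beta3)) ^+ 2 *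
    (n1%:R * derive1 g (mu x1) * (n2%:R * derive1 g (mu x2))
      * (n3%:R * derive1 g (mu x3))).
  by move=> x10 x20 x30; exact: det_fisher_info_mitscherlich.
clearbody detI.
split=> [x1 x2 x3 Lx1 x12 x23 x3U|x2 x3 Lx2 x23 x3U].
  have x10 := le_trans L0 Lx1.
  have x20 := le_lt_trans x10 x12.
  have x30 := lt_trans x20 x23.
  rewrite detE ?(ltW x20, ltW x30) // xlnx_gap_powR //.
  by rewrite mulrA divfK ?gt_eqF // exprMn.
have x20 := le_lt_trans L0 Lx2.
have x30 := lt_trans x20 x23.
have attmu x : L <= x <= U -> attainable_means L U beta (mu x).
  by move=> LxU; exists x.
have g1_gt0 x : L <= x <= U -> 0 < derive1 g (mu x).
  move=> /attmu mux; rewrite lt_def g1_ge0 // andbT.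
  exact: canonical_link_derive_neq0 link (attM _ mux).
have powRlt x y : 0 <= x -> x < y -> x `^ beta3 < y `^ beta3.
  move=> x0 xy; apply: gt0_ltr_powR; rewrite ?nnegrE //.
  exact: le_trans x0 (ltW xy).
have gap_gt0 x : 0 <= x -> x < x2 ->
    0 < xlnx_gap (x `^ beta3) (x2 `^ beta3) (x3 `^ beta3).
  by move=> x0 xx2; rewrite xlnx_gap_gt0 ?powR_ge0 ?powRlt ?(ltW x20).
have g1_le x : L <= x <= U -> derive1 g (mu x) <= derive1 g (mu L).
  move=> /andP[Lx xU].
  have x0 := le_trans L0 Lx.
  have muitv m : mu L <= m <= mu x -> attainable_means L U beta m.
    move=> /andP[Lm mx].
    apply: attainable_means_itv; rewrite ?(ltW LU) // Lm /=.
    by apply: le_trans mx _; exact: mitscherlich_le.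
  have [_ [_ dg] _ _] := link.
  apply: (concave_derive1_le dg); first exact: mitscherlich_le.
  - by move=> m; rewrite /= in_itv /= => /muitv/attM.
  - by move=> m /muitv/g2_le0.
(* From here on the mean enters only through the bounds on g'. *)
clearbody mu.
move=> x1opt; apply: is_argmax_left => // x Lx xx2.
have x0 := le_lt_trans L0 Lx.
rewrite !detE ?(ltW x0, ltW x20, ltW x30) //.
have LxU : L <= x <= U by lra.
have Lx2U : L <= x2 <= U by lra.
have Lx3U : L <= x3 <= U by lra.
have c0 : 0 < beta2 / beta3 by rewrite divr_gt0.
have w2 : 0 < n2%:R * derive1 g (mu x2) by rewrite mulr_gt0 ?ltr0n ?g1_gt0.
have w3 : 0 < n3%:R * derive1 g (mu x3) by rewrite mulr_gt0 ?ltr0n ?g1_gt0.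
have gapx := gap_gt0 _ (ltW x0) xx2.
have gapL := gap_gt0 _ L0 Lx2.
have w1 : 0 < n1%:R * derive1 g (mu x) by rewrite mulr_gt0 ?ltr0n ?g1_gt0.
(* The intermediate value takes the gap at [L] and the weight at [x]. *)
apply: (lt_le_trans (y := (beta2 / beta3
    * xlnx_gap (L `^ beta3) (x2 `^ beta3) (x3 `^ beta3)) ^+ 2
    * (n1%:R * derive1 g (mu x) * (n2%:R * derive1 g (mu x2))
    * (n3%:R * derive1 g (mu x3))))).
  rewrite ltr_pM2r ?(mulr_gt0 (mulr_gt0 w1 w2) w3) // ltr_pXn2r ?nnegrE //.
  - rewrite ltr_pM2l //; apply: xlnx_gap_ltr; rewrite ?powR_ge0 ?powRlt //.
    + exact/ltW/powRlt/xx2/ltW.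
    + exact: ltW.
  - by rewrite ltW // (mulr_gt0 c0).
  - by rewrite ltW // (mulr_gt0 c0).
rewrite ler_pM2l ?exprn_gt0 ?(mulr_gt0 c0) // !(ler_pM2r w2, ler_pM2r w3).
by rewrite ler_pM2l ?ltr0n ?g1_le.
Qed.
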